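(* For every $\epsilon>0$, almost all graphs have Prague dimension $d$ satisfying $$d\ \ge\ \frac{1}{1+\epsilon}\left(\frac{n-1}{2\log n}-\frac1n\right),$$ where $n$ is the number of vertices. That is, for every $\epsilon>0$, if $N_n$ denotes the number of labeled simple graphs $G$ on $n$ vertices with $\dim_P(G)\ge \frac{1}{1+\epsilon}\left(\frac{n-1}{2\log n}-\frac1n\right)$, then $N_n/2^{\binom n2}\to 1$ as $n\to\infty$.
   Context: Here $\log$ is the logarithm to base $2$. The categorical product $G_1\times G_2$ of graphs has vertex set $V(G_1)\times V(G_2)$, with $(u_1,u_2)$ and $(v_1,v_2)$ adjacent iff $u_1v_1\in E(G_1)$ and $u_2v_2\in E(G_2)$. The Prague dimension $\dim_P(G)$ of a finite simple graph $G$ is the minimal (positive) integer $d$ such that $G$ is isomorphic to an induced subgraph of a categorical product of $d$ complete graphs. A graph property holds for almost all graphs if the number of labeled $n$-vertex graphs having the property, divided by $2^{\binom n2}$, tends to $1$ as $n\to\infty$. *)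

(* Defs.v *)
From mathcomp Require Import all_boot all_order all_algebra.
From mathcomp Require Import all_classical all_reals all_analysis.
Import Order.TTheory GRing.Theory Num.Theory.
Import numFieldNormedType.Exports.

Set Implicit Arguments.
Unset Strict Implicit.
Unset Printing Implicit Defensive.

Local Open Scope set_scope.

Record sgraph := SGraph {
  vertex :> finType;
  edge : rel vertex;
  edge_sym : symmetric edge;
  edge_irr : irreflexive edge }.

Definition graph_iso (G H : sgraph) : Prop :=
  exists2 f : G -> H, bijective f & forall x y, edge (f x) (f y) = edge x y.

Definition induced (G : sgraph) (S : {set G}) : sgraph :=
  @SGraph {x : G | x \in S} (fun x y => edge (val x) (val y))
    (fun x y => edge_sym (val x) (val y)) (fun x => edge_irr (val x)).

Fact complete_sym n : symmetric (fun x y : 'I_n => x != y).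
Proof. by move=> x y; rewrite eq_sym. Qed.

Fact complete_irr n : irreflexive (fun x y : 'I_n => x != y).
Proof. by move=> x; rewrite eqxx. Qed.

Definition complete (n : nat) : sgraph :=
  SGraph (@complete_sym n) (@complete_irr n).

Section CategoricalProduct.
Variables G H : sgraph.

Definition cat_edge (x y : G * H) : bool := edge x.1 y.1 && edge x.2 y.2.

Fact cat_edge_sym : symmetric cat_edge.
Proof.
by move=> x y; rewrite /cat_edge (edge_sym x.1) (edge_sym x.2).
Qed.

Fact cat_edge_irr : irreflexive cat_edge.
Proof. by move=> x; rewrite /cat_edge edge_irr. Qed.

Definition cat_prod : sgraph := SGraph cat_edge_sym cat_edge_irr.

End CategoricalProduct.

(* The categorical product of the [(size ms).+1] complete graphs on [ms] and
   [m] vertices. The nonempty list of sizes is split as [m], [ms] because the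
   empty product would be a single vertex with a loop, which is not simple. *)
Definition complete_prod (m : nat) (ms : seq nat) : sgraph :=
  foldr cat_prod (complete m) (map complete ms).

Definition prague_embeddable (G : sgraph) (d : nat) : Prop :=
  exists m ms, (size ms).+1 = d /\
    exists S : {set complete_prod m ms}, graph_iso G (induced S).

Lemma embedding_induced (G H : sgraph) (f : G -> H) :
    injective f -> (forall x y, edge (f x) (f y) = edge x y) ->
  exists S : {set H}, graph_iso G (induced S).
Proof.
move=> finj fE; exists [set f x | x in [set: G]].
have fS x : f x \in [set f x | x in [set: G]] by rewrite imset_f ?inE.
exists (fun x => exist _ (f x) (fS x) : induced _); last first.
  by move=> x y; apply: fE.
apply: inj_card_bij => [x y [] /finj //|].
by rewrite card_sig card_imset ?cardsT // -[leqRHS]cardsT.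
Qed.

Lemma colorings_embedding (T : finType) (n : nat) (c0 : T -> 'I_n)
    (cs : seq (T -> 'I_n)) :
  exists2 f : T -> complete_prod n (map (fun=> n) cs),
    (forall x y, f x = f y -> c0 x = c0 y) &
    (forall x y, edge (f x) (f y) = all (fun c => c x != c y) (rcons cs c0)).
Proof.
elim: cs => [|c cs [f f0 fE]] /=.
  by exists c0 => // x y; rewrite /= andbT.
exists (fun x => (c x, f x)) => [x y [_ /f0] //|x y].
by rewrite /= /cat_edge /= fE.
Qed.

Lemma prague_embeddable_ex (G : sgraph) :
  exists d, `[< prague_embeddable G d >].
Proof.
pose n := #|G|.
pose col (p : G * G) (x : G) : 'I_n :=
  enum_rank (if x == p.1 then p.2 else x).
pose ps := [seq p <- enum {: G * G} | ~~ edge p.1 p.2].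
have [f f0 fE] := colorings_embedding (@enum_rank G) (map col ps).
exists (size (map (fun=> n) (map col ps))).+1; apply/asboolP.
exists n, (map (fun=> n) (map col ps)); split=> //.
apply: (@embedding_induced _ _ f) => [x y /f0/enum_rank_inj //|x y].
rewrite fE all_rcons all_map; apply/idP/idP.
  move=> /andP[_ /allP xyP]; apply/negPn/negP => nxy.
  have /xyP/= : (x, y) \in ps by rewrite mem_filter nxy mem_enum.
  by rewrite /col /= eqxx if_same eqxx.
move=> xy; have nexy : x != y.
  by apply: contraTneq xy => ->; rewrite edge_irr.
rewrite (inj_eq (@enum_rank_inj G)) nexy; apply/allP => -[u v].
rewrite mem_filter /= => /andP[nuv _].
rewrite /col /= (inj_eq (@enum_rank_inj G)).
have [xu|_] := eqVneq x u; have [yu|_] := eqVneq y u => //.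
- by rewrite xu yu eqxx in nexy.
- by apply: contraNneq nuv => ->; rewrite -xu.
- by apply: contraNneq nuv => <-; rewrite edge_sym -yu.
Qed.

Definition prague_dim (G : sgraph) : nat := ex_minn (prague_embeddable_ex G).

Section LabeledGraphs.
Variable n : nat.

(* A labeled graph on ['I_n] is represented by its set of edges. *)
Definition labeled_graphs : {set {set {set 'I_n}}} :=
  powerset [set e : {set 'I_n} | #|e| == 2].

(* The conjunct [x != y] only matters for [E] outside [labeled_graphs]; it makes
   [graph_of] total. *)
Definition edge_of (E : {set {set 'I_n}}) (x y : 'I_n) : bool :=
  (x != y) && ([set x; y] \in E).

Fact edge_of_sym E : symmetric (edge_of E).
Proof. by move=> x y; rewrite /edge_of eq_sym finset.setUC. Qed.

Fact edge_of_irr E : irreflexive (edge_of E).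
Proof. by move=> x; rewrite /edge_of eqxx. Qed.

Definition graph_of (E : {set {set 'I_n}}) : sgraph :=
  SGraph (@edge_of_sym E) (@edge_of_irr E).

Lemma card_labeled_graphs : #|labeled_graphs| = 2 ^ 'C(n, 2).
Proof. by rewrite card_powerset card_draws card_ord. Qed.

Definition num_graphs (P : pred sgraph) : nat :=
  #|[set E in labeled_graphs | P (graph_of E)]|.

End LabeledGraphs.

Local Open Scope ring_scope.
Local Open Scope classical_set_scope.

Definition almost_all_graphs (R : realType) (P : pred sgraph) : Prop :=
  (fun n => (num_graphs n P)%:R / (2 ^ 'C(n, 2))%:R : R) @ \oo --> (1 : R).

Definition log2 (R : realType) (x : R) : R := ln x / ln 2.

(* Main.v *)
(* A graph on [n] vertices of Prague dimension at most [D] is determined by [D]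
   colourings of its vertices with [n] colours, two vertices being adjacent iff
   all the colourings separate them. Hence there are at most [n ^ (n * D)] such
   labeled graphs, and if [D <= (n - 1) / (2 log n) - 1 / n] then this is at most
   [2 ^ 'C(n, 2) / n]. *)
Require Import Defs.
From mathcomp Require Import all_boot all_order all_algebra.
From mathcomp Require Import all_classical all_reals all_analysis.
From mathcomp Require Import ring lra.
Import Order.TTheory GRing.Theory Num.Theory.
Import numFieldNormedType.Exports.
Local Open Scope ring_scope.

(** The colourings are the coordinate projections. Taking colours in [nat] lets factors of different
    sizes share one list. *)
Lemma complete_prod_colorings (m : nat) (ms : seq nat) :
  exists2 cs : seq (complete_prod m ms -> nat), size cs = (size ms).+1 &
    forall x y, edge x y = all (fun c => c x != c y) cs.
Proof.
elim: ms => [|k ms [cs szcs csE]] /=.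
  by exists [:: @nat_of_ord m] => // x y; rewrite /= andbT.
exists ((fun x => @nat_of_ord k x.1) :: [seq (fun x => c x.2) | c <- cs]).
  by rewrite /= size_map szcs.
by move=> x y; rewrite /= all_map /cat_edge csE.
Qed.

(** Each colour is replaced by a chosen vertex of its class. So the number of colourings to count
    depends on [T] alone, however large the complete graphs are. *)
Lemma recolor (T : finType) (U : eqType) (c : T -> U) :
  exists c' : {ffun T -> T}, forall x y, (c' x == c' y) = (c x == c y).
Proof.
pose r x := odflt x [pick z | c z == c x].
have cr x : c (r x) = c x by rewrite /r; case: pickP => [z /eqP|].
exists [ffun x => r x] => x y; rewrite !ffunE.
apply/eqP/eqP => [rxy|cxy]; first by rewrite -(cr x) rxy cr.
rewrite /r (eq_pick (Q := fun z => c z == c y)) => [|z /=]; last by rewrite cxy.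
(* Only the defaults of [odflt] still differ, and they are never reached: [y] lies in its own
   class. *)
by case: pickP => // /(_ y); rewrite eqxx.
Qed.

Lemma prague_colorings (G : sgraph) (d D : nat) :
    prague_embeddable G d -> (d <= D)%N ->
  exists c : {ffun 'I_D -> {ffun G -> G}},
    forall x y, edge x y = [forall i, c i x != c i y].
Proof.
move=> [m [ms [<- [S [f _ fE]]]]] leD.
have [cs szcs csE] := complete_prod_colorings m ms.
(* The first colouring serves as default: indices from [size cs] up to [D] repeat it, which adds no
   condition on the edges. *)
pose c0 : complete_prod m ms -> nat := nth (fun=> 0%N) cs 0.
have /choice[c cE] (i : 'I_D) := recolor _ _ (fun x => nth c0 cs i (val (f x))).
exists (finfun c) => x y; rewrite -fE /= csE.
apply/(all_nthP c0)/forallP => [cs_xy i|c_xy i ilt].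
  rewrite ffunE cE; have [/cs_xy//|lei] := ltnP i (size cs).
  rewrite nth_default //; have := cs_xy 0%N.
  by rewrite (set_nth_default (fun=> 0%N)) szcs //; apply.
have iD : (i < D)%N by apply: leq_trans leD; rewrite -szcs.
by have := c_xy (Ordinal iD); rewrite ffunE cE.
Qed.

Lemma card_prague_dim_le (n D : nat) :
  (num_graphs n (fun G => prague_dim G <= D)%N <= n ^ (n * D))%N.
Proof.
(* Decodes a family of colourings into an edge set. Every [E] to be counted lies in the image of
   [dec]. *)
pose dec (c : {ffun 'I_D -> {ffun 'I_n -> 'I_n}}) : {set {set 'I_n}} :=
  [set [set p.1; p.2] | p in [pred p | [forall i, c i p.1 != c i p.2]]].
have -> : (n ^ (n * D) = #|{ffun 'I_D -> {ffun 'I_n -> 'I_n}}|)%N.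
  by rewrite !card_ffun !card_ord expnM.
apply: leq_trans (leq_imset_card dec predT).
apply/subset_leq_card/fintype.subsetP => E.
rewrite !inE => /andP[/fintype.subsetP Esub].
rewrite /prague_dim; case: ex_minnP => d /asboolP emb _.
move=> /(prague_colorings _ _ _ emb)[c cE].
apply/imsetP; exists c => //; apply/setP => e; apply/idP/imsetP.
  move=> eE; have /Esub := eE; rewrite inE => /cards2P[x [y [xy exy]]].
  by exists (x, y); rewrite // inE -[X in is_true X]cE /= /edge_of xy -exy.
by move=> [[x y]]; rewrite inE /= -cE /= /edge_of => /andP[_ ?] ->.
Qed.

Lemma natr_bin2 (R : realFieldType) (n : nat) :
  'C(n, 2)%:R = n%:R * (n%:R - 1) / 2 :> R.
Proof.
case: n => [|n]; first by rewrite bin0n mul0r mul0r.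
have := congr1 (fun k => k%:R : R) (bin_ffact n.+1 2).
rewrite /= ffactnS ffactn1 !natrM -[n.+1%:R]natr1 /=.
by move=> h; lra.
Qed.

Lemma expn_le_exp2_bin2 (R : realType) (n D : nat) :
    (1 < n)%N ->
    D%:R <= (n%:R - 1) / (2 * log2 n%:R) - 1 / n%:R :> R ->
  (n * n ^ (n * D) <= 2 ^ 'C(n, 2))%N.
Proof.
move=> n1 leD.
have n0 : 0 < n%:R :> R by rewrite ltr0n ltnW.
have lnn : 0 < ln n%:R :> R by rewrite ln_gt0 // ltr1n.
have ln2 : 0 < ln 2 :> R by rewrite ln_gt0 // ltr1n.
rewrite -(ler_nat R) natrM !natrX -ler_ln ?posrE ?mulr_gt0 ?exprn_gt0 //.
rewrite lnM ?posrE ?exprn_gt0 // !lnXn //.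
rewrite -[_ *+ (n * D)]mulr_natl -[_ *+ 'C(_, _)]mulr_natl.
rewrite natr_bin2 natrM.
(* After taking logarithms, the claim is the hypothesis multiplied by [n * ln n]. The term [1 / n]
   becomes [ln n], which pays for the extra factor [n]. *)
have := ler_wpM2r (ltW (mulr_gt0 n0 lnn)) leD.
have -> : ((n%:R - 1) / (2 * log2 n%:R) - 1 / n%:R) * (n%:R * ln n%:R) =
  n%:R * (n%:R - 1) / 2 * ln 2 - ln n%:R :> R.
  by rewrite /log2; field; rewrite ?gt_eqF.
by move=> ?; lra.
Qed.

Theorem theorem5 (R : realType) (eps : R) (eps_gt0 : 0 < eps) :
  almost_all_graphs R (fun G : sgraph =>
    let n : R := #|G|%:R in
    1 / (1 + eps) * ((n - 1) / (2 * log2 n) - 1 / n) <= (prague_dim G)%:R).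
Proof.
set P := (X in almost_all_graphs _ X).
(* At most a fraction [1 / n] of the graphs violates the bound. *)
have bad n : (1 < n)%N -> (n * num_graphs n (fun G => ~~ P G) <= 2 ^ 'C(n, 2))%N.
  move=> n1; pose X : R := (n%:R - 1) / (2 * log2 n%:R) - 1 / n%:R.
  have PE (E : {set {set 'I_n}}) : P (graph_of E) = (1 / (1 + eps) * X <= (prague_dim (graph_of E))%:R).
    by rewrite /P /= card_ord.
  (* For negative [X] no graph violates the bound. Otherwise a violating graph has dimension below
     [X / (1 + eps) <= X], hence at most the integer part of [X], which is taken as [D]. *)
  have [X0|X0] := ltP X 0.
    rewrite [num_graphs _ _]eq_card0 ?muln0 // => E.
    rewrite !inE PE (le_trans _ (ler0n _ _)) ?andbF //.
    by rewrite nmulr_lle0 // divr_ge0 ?addr_ge0 // ltW.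
  apply: leq_trans (expn_le_exp2_bin2 R n (Num.truncn X) n1 _); last first.
    by rewrite truncn_le.
  rewrite leq_mul2l; apply/orP; right.
  apply: leq_trans (card_prague_dim_le _ _).
  apply/subset_leq_card/fintype.subsetP => E; rewrite !inE PE => /andP[-> /=].
  rewrite -ltNge => ltX; rewrite truncn_ge_nat //.
  apply: le_trans (ltW ltX) _.
  rewrite ler_piMl // div1r invf_le1 ?ltr_pwDl ?ltW //.
  by rewrite ltrDl.
have sum_good_bad n :
    (num_graphs n P + num_graphs n (fun G => ~~ P G) = 2 ^ 'C(n, 2))%N.
  rewrite -card_labeled_graphs.
  rewrite -(cardsID [set E | P (graph_of E)] (labeled_graphs n)).
  by congr (_ + _)%N; apply: eq_card => E; rewrite !inE // andbC.
apply: (@squeeze_cvgr _ _ _ _ (fun n => 1 - n%:R^-1) (fun=> 1)).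
- near=> n.
  have n1 : (1 < n)%N by near: n; exists 2.
  have n0 : 0 < n%:R :> R by rewrite ltr0n ltnW.
  have C0 : 0 < (2 ^ 'C(n, 2))%:R :> R by rewrite ltr0n expn_gt0.
  apply/andP; split; last first.
    by rewrite ler_pdivrMr // mul1r ler_nat -sum_good_bad leq_addr.
  have := bad n n1; rewrite -(ler_nat R) natrM mulrC -ler_pdivlMr // => badn.
  have := congr1 (fun k => k%:R : R) (sum_good_bad n); rewrite /= natrD.
  by rewrite ler_pdivlMr // mulrBl mul1r [_^-1 * _]mulrC; move: badn; lra.
- suff : ((fun n => 1 - n%:R^-1) @ \oo --> (1 - 0 : R))%classic by rewrite subr0.
  (* The harmonic sequence is [1 / n.+1], hence the shift. *)
  by apply: cvgB; [exact: cvg_cst | rewrite -cvg_shiftS; exact: cvg_harmonic].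
- exact: cvg_cst.
Unshelve. all: by end_near.
Qed.
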